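(* Let $A$ be a finite set and $C$ a natural number. On a probability space let $(x_i)_{i\ge1}$ be random variables taking values in $A$ and, for each prime $p$, let $y_p$ be a random variable in $\mathbb{Z}/p\mathbb{Z}$. Assume: (i) for every $P$, the vector $(y_p)_{p\le P}$ is uniformly distributed in $\prod_{p\le P}\mathbb{Z}/p\mathbb{Z}$; (ii) for all $i,m\in\mathbb{N}$, $(x_1,\dots,x_m)$ and $(x_{i+1},\dots,x_{i+m})$ have the same distribution; (iii) for every $P$, every $b\in\prod_{p\le P}\mathbb{Z}/p\mathbb{Z}$, all $i,m$ and every $S\subset A^m$, $\mathbb{P}((x_1,\dots,x_m)\in S\mid (y_p)_{p\le P}=b)=\mathbb{P}((x_{i+1},\dots,x_{i+m})\in S\mid (y_p)_{p\le P}=b+i)$, where $b+i$ adds $i$ in every coordinate. For each power of two $P$ put $X_P=(x_1,\dots,x_{CP})$ and $Y_P=(y_p)_{P/2<p\le P}$; for each prime $P/2<p\le P$ let $f_{P,p}\colon A^{CP}\times\mathbb{Z}/p\mathbb{Z}\to\mathbb{C}$ be $1$-bounded and set $f_P(X_P,Y_P)=\mathbb{E}_{P/2<p\le P}f_{P,p}(X_P,y_p)$. Let $W_P$ be a random variable with the same distribution as $Y_P$ and independent of $X_P$. Then \[ \liminf_{P\to\infty,\ P\text{ a power of }2}\ \mathbb{E}\big|f_P(X_P,Y_P)-f_P(X_P,W_P)\big|=0 . \]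
   Context: $p$ always denotes a prime, and $\mathbb{E}_{P/2<p\le P}$ is the uniform average over primes in $(P/2,P]$; for $W_P=(w_p)$, $f_P(X_P,W_P)=\mathbb{E}_{P/2<p\le P}f_{P,p}(X_P,w_p)$. *)

(* Defs.v *)
From Stdlib Require Import Reals.
From mathcomp Require Import all_boot.
Set Implicit Arguments. Unset Strict Implicit. Unset Printing Implicit Defensive.
Delimit Scope R_scope with Re.

(* A value of (x_1,...,x_m) : element of A^m, coordinate j <-> x_{j+1}. *)
Notation Xc A m := ({ffun 'I_m -> A}) (only parsing).

(* A value of (y_p)_{p <= P}: a function on {0..P}; it is a genuine element
   of prod_{p<=P prime} Z/pZ when it is [validY] (coordinate p is < p for p
   prime and 0 for p not prime). *)
Notation Yc P := ({ffun 'I_P.+1 -> 'I_P.+1}) (only parsing).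

Definition validY (P : nat) (b : Yc P) : bool :=
  [forall p : 'I_P.+1, if prime p then (b p < p)%N else (val (b p) == 0%N)].

Definition NP (P : nat) : nat := (\prod_(p < P.+1 | prime p) p)%N.

Definition restrictY (P : nat) (b : Yc P.+1) : Yc P :=
  [ffun p : 'I_P.+1 => inord (b (widen_ord (leqnSn P.+1) p))].

Definition shiftY (P : nat) (i : nat) (b : Yc P) : Yc P :=
  [ffun p : 'I_P.+1 => if prime p then inord ((b p + i) %% p) else ord0].

Definition snocX (A : finType) (m : nat) (a : Xc A m) (c : A) : Xc A m.+1 :=
  [ffun j : 'I_m.+1 => if unlift ord_max j is Some j' then a j' else c].

Definition window (A : finType) (i m : nat) (a : Xc A (i + m)) : Xc A m :=
  [ffun j : 'I_m => a (rshift i j)].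

Definition Rsum (T : finType) (Pr : pred T) (F : T -> R) : R :=
  bigop R0 (index_enum T) (fun t => BigBody t Rplus (Pr t) (F t)).

(* ---------- the process, as its consistent family of finite-dim laws ---
   mu m P a b = Prob( (x_1..x_m) = a  and  (y_p)_{p<=P} = b ). *)
Definition law (A : finType) : Type :=
  forall m P : nat, Xc A m -> Yc P -> R.

Definition is_process (A : finType) (mu : law A) : Prop :=
  (forall m P a b, (0 <= mu m P a b)%Re) /\
  (forall m P (a : Xc A m) (b : Yc P),
      mu m P a b = Rsum predT (fun c : A => mu m.+1 P (snocX a c) b)) /\
  (forall m P (a : Xc A m) (b : Yc P),
      mu m P a b = Rsum (fun b' : Yc P.+1 => restrictY b' == b)
                        (fun b' => mu m P.+1 a b')).

Definition probY (A : finType) (mu : law A) (P : nat) (b : Yc P) : R :=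
  Rsum predT (fun a : Xc A 0 => mu 0 P a b).

Definition probX (A : finType) (mu : law A) (m : nat) (a : Xc A m) : R :=
  Rsum predT (fun b : Yc 0 => mu m 0 a b).

Definition hyp_uniform (A : finType) (mu : law A) : Prop :=
  forall P (b : Yc P),
    probY mu b = (if validY b then / INR (NP P) else 0)%Re.

Definition hyp_stationary (A : finType) (mu : law A) : Prop :=
  forall i m (a : Xc A m),
    probX mu a = Rsum (fun a' : Xc A (i + m) => window a' == a) (@probX A mu (i + m)).

Definition hyp_cond_shift (A : finType) (mu : law A) : Prop :=
  forall P (b : Yc P), validY b ->
  forall i m (S : {set Xc A m}),
    (Rsum (fun a : Xc A m => a \in S) (fun a => mu m P a b) / probY mu b =
     Rsum (fun a' : Xc A (i + m) => window a' \in S)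
          (fun a' => mu (i + m)%N P a' (shiftY i b)) / probY mu (shiftY i b))%Re.

Definition midp (k : nat) (p : 'I_(2 ^ k).+1) : bool :=
  prime p && (2 ^ k < 2 * p)%N.

Definition cntmid (k : nat) : nat := #|[pred p : 'I_(2 ^ k).+1 | midp p]|.

Definition avgmid (k : nat) (g : 'I_(2 ^ k).+1 -> R) : R :=
  if cntmid k is 0 then R0
  else (Rsum (@midp k) g / INR (cntmid k))%Re.

(* the middle part Y_P = (y_p)_{P/2<p<=P} of (y_p)_{p<=P}, encoded in Yc P
   with the other coordinates set to 0 *)
Definition midY (k : nat) (b : Yc (2 ^ k)) : Yc (2 ^ k) :=
  [ffun p : 'I_(2 ^ k).+1 => if (2 ^ k < 2 * p)%N then b p else ord0].

Definition cnorm (z : R * R) : R := sqrt (fst z * fst z + snd z * snd z).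

(* f : family f_{P,p}, P = 2^k, values in C = R*R; f k p a y = f_{P,p}(a, y) *)
Definition fam (A : finType) (C : nat) : Type :=
  forall k : nat, nat -> Xc A (C * 2 ^ k) -> nat -> R * R.

Definition one_bounded (A : finType) (C : nat) (f : fam A C) : Prop :=
  forall k p (a : Xc A (C * 2 ^ k)) (y : nat),
    prime p -> (2 ^ k < 2 * p)%N -> (p <= 2 ^ k)%N -> (y < p)%N ->
    (cnorm (f k p a y) <= 1)%Re.

Definition fP (A : finType) (C : nat) (f : fam A C) (k : nat)
    (a : Xc A (C * 2 ^ k)) (w : Yc (2 ^ k)) : R * R :=
  (avgmid (fun p => fst (f k p a (w p))), avgmid (fun p => snd (f k p a (w p)))).

Definition cdiff (z w : R * R) : R * R := (fst z - fst w, snd z - snd w)%Re.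

(* kap a b w = Prob( X_P = a, (y_p)_{p<=P} = b, W_P = w ), where W_P (a
   vector indexed by primes P/2<p<=P) is encoded in Yc P like midY. *)
Definition coupling (A : finType) (C : nat) (mu : law A) (k : nat)
    (kap : Xc A (C * 2 ^ k) -> Yc (2 ^ k) -> Yc (2 ^ k) -> R) : Prop :=
  (forall a b w, (0 <= kap a b w)%Re) /\
  (forall a b, Rsum predT (fun w => kap a b w) = mu (C * 2 ^ k) (2 ^ k) a b) /\
  (forall w : Yc (2 ^ k),
     Rsum predT (fun a => Rsum predT (fun b => kap a b w)) =
     Rsum predT (fun a => Rsum (fun b => midY b == w)
                               (fun b => mu (C * 2 ^ k) (2 ^ k) a b))) /\
  (forall a w,
     Rsum predT (fun b => kap a b w) =
     (Rsum predT (fun b => mu (C * 2 ^ k)%N (2 ^ k)%N a b) *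
      Rsum predT (fun a' => Rsum predT (fun b => kap a' b w)))%Re).

Definition Ediff (A : finType) (C : nat) (f : fam A C) (k : nat)
    (kap : Xc A (C * 2 ^ k) -> Yc (2 ^ k) -> Yc (2 ^ k) -> R) : R :=
  Rsum predT (fun a => Rsum predT (fun b => Rsum predT (fun w =>
    (kap a b w * cnorm (cdiff (fP f a b) (fP f a w)))%Re))).

(* Main.v *)
(** Entropy decrement.  Put P = 2^k and Q = P/2, and let u_k be the conditional entropy
    of X_P given (y_p)_{p <= P}.  Hypothesis (iii) makes the conditional entropy of a block of
    the x_i invariant under translation, so subadditivity gives u_k <= 2 u_{k-1} - I_k, where
    I_k >= 0 is the information between X_P and Y_P given (y_p)_{p <= Q}.  Hence
    the sum of I_k / 2^k converges.  With n_k the number of primes in (P/2, P], the sum of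
    n_k / 2^k diverges (it is comparable to the sum of 1/p), so I_k <= d n_k with n_k large for
    infinitely many k.  For such k the law of (X_P, (y_p)_{p <= P}) has relative entropy at most
    d n_k with respect to the law under which Y_P is independent of (X_P, (y_p)_{p <= Q}); under
    the latter f_P(X_P, .) is an average of n_k independent bounded variables, hence
    exponentially concentrated, and the Gibbs variational inequality transfers the
    concentration to the true law. *)
Require Import Defs.
From Stdlib Require Import Reals.
From mathcomp Require Import all_boot all_order all_algebra zify ring lra.
From mathcomp Require Import boolp reals Rstruct sequences exp.
Set Implicit Arguments. Unset Strict Implicit. Unset Printing Implicit Defensive.
Import Order.TTheory GRing.Theory Num.Theory.

(** * Divergence of the sum of prime reciprocals, at dyadic scales *)

Lemma expn2_dominates c N : exists2 K, N <= K & 2 * K.+1 ^ c <= 2 ^ K.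
Proof.
(* For K + 1 = 2^j the claim reads j c + 2 <= 2^j, and j = 2 i gives 2^j >= (i + 1)^2. *)
pose i := (2 * c + N).+2; pose j := (2 * i)%N.
have jc : j * c + 2 <= 2 ^ j.
  have i2 : i.+1 <= 2 ^ i by exact: ltn_expl.
  rewrite /j mul2n -addnn expnD; apply: leq_trans (leq_mul i2 i2).
  by rewrite /i; nia.
have j0 : j < 2 ^ j by exact: ltn_expl.
exists (2 ^ j).-1; first by rewrite -ltnS prednK; lia.
by rewrite prednK -?expnM -?expnS ?leq_exp2l //; lia.
Qed.

(** An integer with all prime factors at most 2^N is determined by its exponents there, each at most
    K. The power on the right counts all indices 0, ..., 2^N, prime or not. *)
Lemma card_smooth_le N K :
  \sum_(n < 2 ^ K) [forall p : 'I_(2 ^ K).+1,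
      prime p && (p %| n.+1) ==> (p <= 2 ^ N)] <= K.+1 ^ (2 ^ N).+1.
Proof.
pose sm := [pred n : 'I_(2 ^ K) | [forall p : 'I_(2 ^ K).+1,
      prime p && (p %| n.+1) ==> (p <= 2 ^ N)]].
rewrite -(@big_mkcond _ _ _ _ _ sm (fun=> 1)) sum1_card.
pose v (n : 'I_(2 ^ K)) : {ffun 'I_(2 ^ N).+1 -> 'I_K.+1} :=
  [ffun p : 'I_(2 ^ N).+1 => inord (logn p n.+1)].
have logK (n : 'I_(2 ^ K)) p : logn p n.+1 < K.+1.
  have [pp|/negbTE pp] := boolP (prime p); last by rewrite /logn pp.
  rewrite ltnS -(@leq_exp2l 2) //; apply: leq_trans (ltn_ord n).
  apply: leq_trans (_ : p ^ logn p n.+1 <= _).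
    by have [->//|l0] := posnP (logn p n.+1); rewrite leq_exp2r // prime_gt1.
  by rewrite dvdn_leq // pfactor_dvdnn.
have inj : {in sm &, injective v}.
  move=> n1 n2 /forallP s1 /forallP s2 e; apply/val_inj/eq_add_S.
  apply: eqn_from_log => // p.
  have [pN|pN] := leqP p (2 ^ N).
    move/ffunP/(_ (inord p)): e; rewrite !ffunE inordK // => /(congr1 val).
    by rewrite /= !inordK.
  have log0 (n : 'I_(2 ^ K)) : n \in sm -> logn p n.+1 = 0.
    move=> /forallP s; apply/eqP; rewrite -leqn0 leqNgt logn_gt0 mem_primes /=.
    apply/negP => /andP[pp dv].
    have pK : p < (2 ^ K).+1 by rewrite ltnS (leq_trans (dvdn_leq _ dv)).
    by have := s (Ordinal pK); rewrite /= pp dv leqNgt pN.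
  by rewrite !log0 //; apply/forallP.
by have := leq_card_in _ _ inj; rewrite card_ffun !card_ord.
Qed.

Lemma sum_dvdn_midp_le K k (p : 'I_(2 ^ k).+1) : k <= K -> midp p ->
  \sum_(n < 2 ^ K) (p %| n.+1) <= 2 ^ (K - k).+1.
Proof.
move=> kK /andP[_ kp].
rewrite -(big_mkord xpredT (fun n => (p %| n.+1) : nat)).
rewrite -(big_add1 _ _ 0 (2 ^ K).+1 xpredT (fun n => (p %| n) : nat)) -divn_count_dvd.
have p0 : 0 < p by lia.
apply: leq_trans (_ : 2 ^ K.+1 %/ 2 ^ k <= _); last first.
  by rewrite -expnB // ?subSn // (leq_trans kK).
rewrite leq_divRL ?expn_gt0 //.
have := leq_divM (2 ^ K) p; have := leq_mul (leqnn (2 ^ K %/ p)) (ltnW kp).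
by rewrite expnS; nia.
Qed.

(** Divergence of the sum of n_k / 2^k in counting form. Each integer up to 2^K either has all prime
    factors at most 2^N or has one in some (2^(k-1), 2^k] with N < k <= K; for suitable K the former
    make up at most half. *)
Lemma prime_scales_heavy N : exists2 K, N <= K &
  2 ^ K <= 2 * \sum_(N.+1 <= k < K.+1) cntmid k * 2 ^ (K - k).+1.
Proof.
have [K0 NK hK] := expn2_dominates (2 ^ N).+1 N.
exists K0 => //.
pose ns (n : nat) := \sum_(N.+1 <= k < K0.+1) \sum_(p < (2 ^ k).+1 | midp p) (p %| n.+1).
have cover (n : 'I_(2 ^ K0)) : 1 <= [forall p : 'I_(2 ^ K0).+1,
      prime p && (p %| n.+1) ==> (p <= 2 ^ N)] + ns n.
  case: forallP => [//|/forallP]; rewrite negb_forall => /existsP[p].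
  rewrite negb_imply -ltnNge add0n => /andP[/andP[pp dv] Np].
  have p1 := prime_gt1 pp.
  pose k := up_log 2 p.
  have [kl ku] : 2 ^ k.-1 < p /\ p <= 2 ^ k by apply/andP/up_log_bounds.
  have Nk : N < k by rewrite -(@ltn_exp2l 2) // (leq_trans Np).
  have kK : k <= K0.
    rewrite -(prednK (leq_ltn_trans (leq0n _) Nk)) -(@ltn_exp2l 2) //.
    exact: leq_trans kl (ltn_ord p).
  rewrite /ns (big_cat_nat _ (n := k)) //=; last by rewrite ltnW.
  rewrite (big_ltn (m := k)) ?ltnS //.
  have pk : p < (2 ^ k).+1 by rewrite ltnS.
  rewrite (bigD1 (Ordinal pk)) /=; first by rewrite dv; lia.
  rewrite /midp /= pp /=.
  by move: kl; rewrite -{2}(prednK (leq_ltn_trans (leq0n _) Nk)) expnS; lia.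
have : 2 ^ K0 <= K0.+1 ^ (2 ^ N).+1 +
    \sum_(N.+1 <= k < K0.+1) cntmid k * 2 ^ (K0 - k).+1.
  have {1}-> : 2 ^ K0 = \sum_(n < 2 ^ K0) 1 by rewrite sum1_card card_ord.
  apply: (leq_trans (leq_sum _ (fun n _ => cover n))).
  rewrite big_split leq_add ?card_smooth_le //.
  rewrite /ns exchange_big /= !big_nat leq_sum // => k /andP[_ kK].
  rewrite exchange_big /= /cntmid -sum1_card big_distrl /=.
  by apply: leq_sum => p mp; rewrite mul1n sum_dvdn_midp_le.
lia.
Qed.

Local Open Scope ring_scope.

(** * Entropy and concentration *)

(** This is ln x <= x - 1 at x = r / q. The condition at r = 0 is absolute continuity, required
    because [ln 0 = 0]. *)
Lemma mul_ln_le (R : realType) (q r : R) : 0 <= q -> 0 <= r -> (r = 0 -> q = 0) ->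
  q * ln r <= q * ln q - q + r.
Proof.
move=> q0 r0 rq; have [q1|q1] := eqVneq q 0; first by rewrite q1 !mul0r; lra.
have qp : 0 < q by rewrite lt_def q1.
have rp : 0 < r by rewrite lt_def r0 andbT; apply: contra_neq q1.
have : ln (r / q) <= r / q - 1.
  have := @le_ln1Dx R (r / q - 1); rewrite addrCA subrr addr0; apply.
  by rewrite ltrBDr addNr divr_gt0.
rewrite ln_div ?posrE // => /(ler_wpM2l q0).
by rewrite !mulrBr mulrCA divff // mulr1; lra.
Qed.

(** Gibbs variational inequality for unnormalised weights: [mul_ln_le] termwise, with r e^g in place
    of r. *)
Lemma sum_mul_ln_exp_le (R : realType) (T : finType) (P : pred T) (q r g : T -> R) :
  (forall t, P t -> 0 <= q t) -> (forall t, P t -> 0 <= r t) ->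
  (forall t, P t -> r t = 0 -> q t = 0) ->
  \sum_(t | P t) q t * g t <= \sum_(t | P t) q t * (ln (q t) - ln (r t))
    - \sum_(t | P t) q t + \sum_(t | P t) r t * expR (g t).
Proof.
move=> q0 r0 rq; rewrite -sumrB -big_split /=; apply: ler_sum => t Pt.
have [rt0|rt0] := eqVneq (r t) 0; first by rewrite (rq _ Pt rt0) rt0; lra.
have rp : 0 < r t by rewrite lt_def rt0 r0.
have := @mul_ln_le R (q t) (r t * expR (g t)) (q0 _ Pt).
rewrite lnM ?posrE ?expR_gt0 // expRK mulrDr mulrBr => h.
suff : q t * ln (r t) + q t * g t <= q t * ln (q t) - q t + r t * expR (g t) by lra.
apply: h; first by rewrite mulr_ge0 ?expR_ge0 ?r0.
by move/eqP; rewrite mulf_eq0 expR_eq0 orbF (negbTE rt0).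
Qed.

Lemma sum_inj_le (R : realType) (T U : finType) (phi : T -> U) (F : U -> R) :
  injective phi -> (forall u, 0 <= F u) -> \sum_t F (phi t) <= \sum_u F u.
Proof.
move=> inj F0; rewrite -(big_imset _ (in2W inj)) /=.
by rewrite [leRHS](bigID (mem [set phi t | t in T])) /= lerDl sumr_ge0.
Qed.

(* [ln 0 = 0], so the terms with [q t = 0] vanish. *)
Definition negent (R : realType) (T : finType) (q : T -> R) : R :=
  \sum_t q t * ln (q t).

Definition marginal (R : realType) (T U : finType) (pi : T -> U) (q : T -> R)
    (u : U) : R :=
  \sum_(t | pi t == u) q t.

Lemma sum_marginal (R : realType) (T U : finType) (pi : T -> U) (q : T -> R)
    (F : U -> R) :
  \sum_t q t * F (pi t) = \sum_u marginal pi q u * F u.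
Proof.
rewrite (partition_big pi xpredT) //=; apply: eq_bigr => u _.
by rewrite big_distrl /=; apply: eq_bigr => t /eqP ->.
Qed.

Lemma marginal_ge0 (R : realType) (T U : finType) (pi : T -> U) (q : T -> R) u :
  (forall t, 0 <= q t) -> 0 <= marginal pi q u.
Proof. by move=> q0; apply: sumr_ge0. Qed.

Lemma marginal_ge (R : realType) (T U : finType) (pi : T -> U) (q : T -> R) t :
  (forall t, 0 <= q t) -> q t <= marginal pi q (pi t).
Proof. by move=> q0; rewrite /marginal (bigD1 t) //= lerDl sumr_ge0. Qed.

Lemma sum_marginal1 (R : realType) (T U : finType) (pi : T -> U) (q : T -> R) :
  \sum_u marginal pi q u = \sum_t q t.
Proof. by rewrite [RHS](partition_big pi xpredT). Qed.

(** Subadditivity of entropy at total mass v, by comparing q with the product r of its marginals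
    divided by v. Injectivity bounds the mass of r on [T] by v. *)
Lemma negent_superadditive (R : realType) (T U V : finType)
    (pi1 : T -> U) (pi2 : T -> V) (q : T -> R) (v := \sum_t q t) :
  injective (fun t => (pi1 t, pi2 t)) -> (forall t, 0 <= q t) ->
  negent (marginal pi1 q) + negent (marginal pi2 q) <= negent q + v * ln v.
Proof.
move=> inj q0; pose q1 := marginal pi1 q; pose q2 := marginal pi2 q.
have q1_0 u : 0 <= q1 u by exact: marginal_ge0.
have q2_0 u : 0 <= q2 u by exact: marginal_ge0.
have v0 : 0 <= v by exact: sumr_ge0.
have qv t : q t <= v by rewrite /v (bigD1 t) //= lerDl sumr_ge0.
pose r t := q1 (pi1 t) * q2 (pi2 t) / v.
have pos t : q t != 0 -> [/\ 0 < q t, 0 < q1 (pi1 t), 0 < q2 (pi2 t) & 0 < v].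
  move=> qt; have qp : 0 < q t by rewrite lt_def qt q0.
  by split => //; apply: lt_le_trans qp _ => //; exact: marginal_ge.
have r0 t : 0 <= r t by rewrite !mulr_ge0 ?invr_ge0.
have rsum : \sum_t r t <= v.
  apply: le_trans (@sum_inj_le R T (U * V)%type _
    (fun w => q1 w.1 * q2 w.2 / v) inj _) _ => /=.
    by move=> w; rewrite !mulr_ge0 ?invr_ge0.
  rewrite -(pair_bigA _ (fun u w => q1 u * q2 w / v)) /=.
  under eq_bigr do rewrite -mulr_suml -mulr_sumr.
  rewrite -mulr_suml -mulr_suml !sum_marginal1 -/v.
  have [->|vn0] := eqVneq v 0; first by rewrite !mul0r.
  by rewrite mulfK.
have h : \sum_t q t * ln (r t) <= negent q.
  apply: (@le_trans _ _ (\sum_t (q t * ln (q t) - q t + r t))).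
    apply: ler_sum => t _; apply: mul_ln_le => // rt0; apply/eqP.
    apply: contraT => /pos[_ h1 h2 h3].
    by have := divr_gt0 (mulr_gt0 h1 h2) h3; rewrite -/(r t) rt0 ltxx.
  by rewrite big_split sumrB /= -/(negent q); move: rsum; rewrite /v; lra.
have e : \sum_t q t * ln (r t) = negent q1 + negent q2 - v * ln v.
  rewrite /negent -!sum_marginal -/q1 -/q2 /v mulr_suml -big_split -sumrB /=.
  apply: eq_bigr => t _; have [->|/pos[_ h1 h2 h3]] := eqVneq (q t) 0.
    by rewrite !mul0r addr0 subr0.
  by rewrite /r ln_div ?posrE ?mulr_gt0 // lnM ?posrE // -/v; ring.
by move: h; rewrite e -/q1 -/q2; lra.
Qed.

(** * Exponential concentration for sums of independent bounded variables *)

Lemma expR_le_quad (R : realType) (x : R) : x <= 2^-1 -> expR x <= 1 + x + 2 * x ^+ 2.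
Proof.
move=> x2; have := expR_ge1Dx (- x); rewrite expRN.
have := expR_gt0 x; set e := expR x => e0 h.
have e1 : e * (1 - x) <= 1.
  by rewrite -[leRHS](@mulfV _ e) ?gt_eqF // ler_pM2l.
have x20 : 0 <= x ^+ 2 by exact: sqr_ge0.
(* The right side equals 1 + x^2 (1 - 2 x), which is at least 1 for x <= 1/2. *)
have : (1 - x) * e <= (1 - x) * (1 + x + 2 * x ^+ 2).
  rewrite mulrC (le_trans e1) //.
  have : 0 <= x ^+ 2 * (1 - 2 * x) by rewrite mulr_ge0 //; lra.
  by rewrite !exprS expr0; lra.
by rewrite ler_pM2l //; lra.
Qed.

Definition mean (R : realType) (T : finType) (Q : pred T) (h : T -> R) : R :=
  (\sum_(y | Q y) h y) / #|Q|%:R.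

Lemma mean_bound (R : realType) (T : finType) (Q : pred T) (h : T -> R) :
  (forall y, Q y -> `|h y| <= 1) -> `|mean Q h| <= 1.
Proof.
move=> h1; rewrite /mean; have [->|c0] := eqVneq #|Q| 0%N.
  by rewrite invr0 mulr0 normr0.
rewrite normrM normfV normr_nat ler_pdivrMr ?ltr0n ?lt0n // mul1r.
apply: le_trans (ler_norm_sum _ _ _) _.
by apply: le_trans (ler_sum _ h1) _; rewrite sumr_const.
Qed.

(** Summing the quadratic bound over [Q] kills the linear term, h being centred. As |h - mean| <= 2,
    the bound on l keeps the exponent at most 1/2, and 2 l^2 2^2 = 8 l^2. *)
Lemma expR_moment (R : realType) (T : finType) (Q : pred T) (h : T -> R) (l : R) :
  (forall y, Q y -> `|h y| <= 1) -> `|l| <= 4^-1 ->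
  \sum_(y | Q y) expR (l * (h y - mean Q h)) <= #|Q|%:R * expR (8 * l ^+ 2).
Proof.
move=> h1 l4; have m1 := mean_bound h1; set m := mean Q h in m1 *.
have b y : Q y -> expR (l * (h y - m)) <= 1 + l * (h y - m) + 8 * l ^+ 2.
  move=> Qy; have d2 : `|h y - m| <= 2.
    by apply: le_trans (ler_normB _ _) _; have := h1 _ Qy; lra.
  apply: le_trans (expR_le_quad _) _.
    apply: le_trans (ler_norm _) _; rewrite normrM.
    by apply: le_trans (ler_pM _ _ l4 d2) _ => //; lra.
  rewrite lerD2l exprMn.
  have : (h y - m) ^+ 2 <= 4.
    rewrite -real_normK ?num_real // (_ : 4 = 2 ^+ 2 :> R); last by ring.
    by rewrite lerXn2r ?nnegrE.
  by move/(ler_wpM2l (sqr_ge0 l)); lra.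
apply: le_trans (ler_sum _ b) _.
have [Q0|c0] := eqVneq #|Q| 0%N.
  rewrite Q0 mul0r big_pred0 // => y; apply/negbTE/negP => Qy.
  by move/card0_eq: Q0 => /(_ y); rewrite unfold_in Qy.
have -> : \sum_(y | Q y) (1 + l * (h y - m) + 8 * l ^+ 2)
    = #|Q|%:R * (1 + 8 * l ^+ 2).
  rewrite !big_split /= -mulr_sumr sumrB /= !sumr_const.
  have -> : \sum_(y | Q y) h y = m * #|Q|%:R.
    by rewrite /m /mean mulfVK // pnatr_eq0.
  by rewrite -[m *+ _]mulr_natr -[_ *+ #|_|]mulr_natr; ring.
by rewrite ler_wpM2l // expR_ge1Dx.
Qed.

Definition deviation (R : realType) (I J : finType) (Q : I -> pred J) (S : pred I)
    (h : I -> J -> R) (b : {ffun I -> J}) : R :=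
  \sum_(i | S i) (h i (b i) - mean (Q i) (h i)).

Lemma card_family_prod (I J : finType) (Q : I -> pred J) :
  #|family Q| = (\prod_i #|Q i|)%N.
Proof.
rewrite -sum1_card (eq_bigr (fun i => \sum_(y in Q i) 1)%N) => [|i _]; last first.
  by rewrite sum1_card.
by rewrite bigA_distr_big_dep /=; apply: eq_bigr => b _; rewrite big1_eq.
Qed.

Section Concentration.
Context (R : realType) (I J : finType) (Q : I -> pred J) (S : pred I).
Context (h : I -> J -> R).
Context (h1 : forall i y, S i -> Q i y -> `|h i y| <= 1).

Local Notation dev := (deviation Q S h).

(** Independence: the sum over a product set factors over coordinates. Those in [S] each contribute
    one [expR_moment], the others their cardinality. *)
Lemma sum_family_expR_le (l : R) : `|l| <= 4^-1 ->
  \sum_(b in family Q) expR (l * dev b)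
    <= (\prod_i #|Q i|)%:R * expR (8 * l ^+ 2 * #|S|%:R).
Proof.
move=> l4.
have -> : \sum_(b in family Q) expR (l * dev b) = \prod_i \sum_(y | Q i y)
    (if S i then expR (l * (h i y - mean (Q i) (h i))) else 1).
  rewrite bigA_distr_big_dep /=; apply: eq_bigr => b _.
  by rewrite /deviation mulr_sumr expR_sum big_mkcond.
have -> : (\prod_i #|Q i|)%:R * expR (8 * l ^+ 2 * #|S|%:R)
  = \prod_i (#|Q i|%:R * (if S i then expR (8 * l ^+ 2) else 1)) :> R.
  by rewrite big_split /= natr_prod -big_mkcond prodr_const -expRM_natr.
apply: ler_prod => i _; apply/andP; split.
  by apply: sumr_ge0 => y _; case: (S i); rewrite ?expR_ge0.
case: ifP => Si; last by rewrite sumr_const mulr1.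
by apply: expR_moment => // y; exact: h1.
Qed.

(** By e^|x| <= e^x + e^(-x); the factor 2 is absorbed by the [- 1] in the exponent, since 2 <= e.
    This normalised form feeds the Gibbs inequality directly. *)
Lemma sum_family_expR_norm_le (l : R) : 0 <= l <= 4^-1 ->
  \sum_(b in family Q) expR (l * `|dev b| - 1 - 8 * l ^+ 2 * #|S|%:R)
    <= (\prod_i #|Q i|)%:R.
Proof.
move=> /andP[l0 l4]; set c := 8 * _ * _.
have b1 b : expR (l * `|dev b| - 1 - c)
    <= (expR (l * dev b) + expR (- l * dev b)) * expR (- 1 - c).
  rewrite -addrA expRD ler_wpM2r ?expR_ge0 ?opprD //.
  have [d0|d0] := ger0P (dev b); first by rewrite lerDl expR_ge0.
  by rewrite mulrN mulNr lerDr expR_ge0.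
apply: le_trans (ler_sum _ (fun b _ => b1 b)) _.
rewrite -mulr_suml big_split /= expRD.
have e1 : 2 * expR (-1) <= 1 :> R.
  have := @expR_ge1Dx R 1; rewrite expRN.
  have := @expR_gt0 R 1; set e := expR 1 => e0 e2.
  by rewrite ler_pdivrMr // mul1r; lra.
have := @sum_family_expR_le l; rewrite ger0_norm // => /(_ l4).
have := @sum_family_expR_le (- l); rewrite normrN ger0_norm // => /(_ l4).
rewrite sqrrN -/c; set x := \sum_(_ in _) _; set y := \sum_(_ in _) _.
set n := (_%:R); move=> hx hy.
have n0 : 0 <= n by [].
have ec : expR c * expR (- c) = 1 by exact: expRxMexpNx_1.
apply: (@le_trans _ _ (2 * (n * expR c) * (expR (-1) * expR (- c)))).
  by rewrite ler_wpM2r ?mulr_ge0 ?expR_ge0 //; lra.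
rewrite (_ : _ * _ = n * (2 * expR (-1)) * (expR c * expR (- c))); last by ring.
by rewrite ec mulr1 ler_piMr.
Qed.
End Concentration.

(** * The process *)

Lemma RsumE (T : finType) (Pr : pred T) (F : T -> R) : Rsum Pr F = \sum_(t | Pr t) F t.
Proof. by []. Qed.

Definition takeX (A : finType) m n (le_mn : (m <= n)%N) (a : Xc A n) : Xc A m :=
  [ffun j : 'I_m => a (widen_ord le_mn j)].

Lemma sum_snocX (A : finType) n (F : Xc A n.+1 -> R) :
  \sum_a F a = \sum_(a : Xc A n) \sum_c F (snocX a c).
Proof.
rewrite pair_bigA /= (reindex (fun ac : Xc A n * A => snocX ac.1 ac.2)) //=.
have snoc_max (a : Xc A n) c : snocX a c ord_max = c by rewrite ffunE unlift_none.
have snoc_lift (a : Xc A n) c j : snocX a c (lift ord_max j) = a j.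
  by rewrite ffunE liftK.
exists (fun a => ([ffun j => a (lift ord_max j)], a ord_max)) => [[a c] _|a _] /=.
  by rewrite snoc_max; congr pair; apply/ffunP => j; rewrite ffunE snoc_lift.
apply/ffunP => j; case: (unliftP ord_max j) => [j' ->|->]; last exact: snoc_max.
by rewrite snoc_lift ffunE.
Qed.

Lemma takeX_snocX (A : finType) m n (le_mn : (m <= n)%N) (le_mn1 : (m <= n.+1)%N)
    (a : Xc A n) c : takeX le_mn1 (snocX a c) = takeX le_mn a.
Proof.
apply/ffunP => j; rewrite !ffunE.
have -> : widen_ord le_mn1 j = lift ord_max (widen_ord le_mn j).
  exact/val_inj/esym/lift_max.
by rewrite liftK.
Qed.

(** * Residue vectors: restriction, shift, product structure *)

Definition resY (Q P : nat) (b : Yc P) : Yc Q :=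
  [ffun p : 'I_Q.+1 => inord (b (inord p))].

(** A value beyond the range is sent to 0 by [inord], whether in one step or two, so restrictions
    compose on all vectors, valid or not. *)
Lemma inord_inord Q P v : (Q <= P)%N -> inord (inord v : 'I_P.+1) = inord v :> 'I_Q.+1.
Proof.
move=> QP; have [vP|vP] := leqP v P; first by rewrite inordK.
have inord0 n : (n < v)%N -> inord v = ord0 :> 'I_n.+1.
  by move=> nv; rewrite /inord /insubd insubN // -leqNgt.
by rewrite !inord0 ?(leq_ltn_trans QP) //; apply: val_inj; rewrite /= inordK.
Qed.

Lemma resY_id P (b : Yc P) : resY P b = b.
Proof. by apply/ffunP => p; rewrite ffunE !inord_val. Qed.

Lemma resY_restrictY Q P (b : Yc P.+1) : (Q <= P)%N ->
  resY Q (restrictY b) = resY Q b.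
Proof.
move=> QP; apply/ffunP => p; rewrite !ffunE inord_inord //.
have pQ : (p <= P)%N by rewrite (leq_trans _ QP) // -ltnS.
congr (inord (b _)); apply: val_inj; rewrite /= !inordK // ltnS.
by rewrite (leq_trans pQ).
Qed.

Lemma shiftY_valid P i (b : Yc P) : validY b -> validY (shiftY i b).
Proof.
move=> vb; apply/forallP => p; rewrite ffunE; case: (boolP (prime p)) => // pp.
by rewrite inordK ?ltn_pmod ?prime_gt0 // (leq_trans (ltn_pmod _ (prime_gt0 pp))) // ltnW.
Qed.

Lemma shiftY_inj P i : {in @validY P &, injective (@shiftY P i)}.
Proof.
move=> b1 b2 /forallP v1 /forallP v2 e; apply/ffunP => p; apply: val_inj.
have := v1 p; have := v2 p; case: ifP => [pp h2 h1|_ /eqP-> /eqP->] //=.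
have lt n : (n %% p < P.+1)%N.
  by rewrite (leq_trans (ltn_pmod _ (prime_gt0 pp))) // ltnW.
move/ffunP/(_ p): e; rewrite !ffunE pp => /(congr1 val); rewrite /= !inordK //.
by move/eqP; rewrite eqn_modDr !modn_small // => /eqP.
Qed.

(** An injection of the finite set of valid vectors into itself is a permutation. *)
Lemma sum_shiftY P i (F : Yc P -> R) :
  \sum_(b | validY b) F (shiftY i b) = \sum_(b | validY b) F b.
Proof.
pose V := [set b | @validY P b].
have injV : {in V &, injective (@shiftY P i)}.
  by move=> b1 b2; rewrite !inE; exact: shiftY_inj.
have im : [set shiftY i b | b in V] = V.
  apply/eqP; rewrite eqEcard card_in_imset // leqnn andbT.
  by apply/subsetP => _ /imsetP[b + ->]; rewrite !inE; exact: shiftY_valid.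
have e G : \sum_(b | validY b) G b = \sum_(b in V) G b :> R.
  by apply: eq_bigl => b; rewrite inE.
by rewrite !e -[in RHS]im big_imset.
Qed.

Lemma NP_gt0 P : (0 < NP P)%N.
Proof. by apply: prodn_cond_gt0 => p /prime_gt0. Qed.

Lemma NPr_gt0 P : 0 < (NP P)%:R :> R.
Proof. by rewrite ltr0n NP_gt0. Qed.

(** Coordinate ranges whose product is the set of valid vectors, so that exponential sums over it
    factor. *)
Definition Yfam (P : nat) (p : 'I_P.+1) : pred 'I_P.+1 :=
  [pred y : 'I_P.+1 | if prime p then (y < p)%N else (val y == 0%N)].

Lemma validY_family P (b : Yc P) : validY b = (b \in family (@Yfam P)).
Proof. by []. Qed.

Lemma card_Yfam P (p : 'I_P.+1) : #|Yfam p| = (if prime p then p : nat else 1)%N.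
Proof.
case: (boolP (prime p)) => pp; last first.
  rewrite -(card1 (ord0 : 'I_P.+1)); apply: eq_card => y.
  by rewrite !inE (negbTE pp).
rewrite -sum1_card -[RHS]card_ord -[RHS]sum1_card.
rewrite (big_ord_widen P.+1 (fun=> 1%N)) ?(ltnW (ltn_ord p)) //.
by apply: eq_bigl => y; rewrite inE pp.
Qed.

Lemma prod_card_Yfam P : (\prod_(p < P.+1) #|Yfam p|)%N = NP P.
Proof. by rewrite /NP [RHS]big_mkcond; apply: eq_bigr => p _; rewrite card_Yfam. Qed.

Lemma sum_valid_inv P : \sum_(b : Yc P | validY b) (NP P)%:R^-1 = 1 :> R.
Proof.
rewrite sumr_const -[_ *+ _]mulr_natr.
have -> : #|@validY P| = NP P.
  by rewrite -prod_card_Yfam -card_family_prod; apply: eq_card => b.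
by rewrite mulVf // lt0r_neq0 // NPr_gt0.
Qed.

(* The fibre of [resY Q] over [b0] among valid vectors is contained in this family. *)
Definition Cfam (Q P : nat) (b0 : Yc Q) (p : 'I_P.+1) : pred 'I_P.+1 :=
  if (p <= Q)%N then (fun y : 'I_P.+1 => val y == b0 (inord p)) : pred _ else Yfam p.

Lemma resY_Cfam Q P (b : Yc P) : (Q <= P)%N -> validY b -> b \in family (Cfam (resY Q b)).
Proof.
move=> QP /forallP vb; apply/familyP => p; rewrite /Cfam.
case: ifPn => pQ; last exact: vb.
rewrite unfold_in /= ffunE.
have -> : inord (inord (val p) : 'I_Q.+1) = p :> 'I_P.+1.
  by rewrite inordK ?inord_val.
rewrite inordK // ltnS; have := vb p; case: ifP => _ => [lt|/eqP ->//].
by rewrite (leq_trans (ltnW lt)).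
Qed.

(** Coordinates up to Q are pinned to one value at most, and the others range freely. *)
Lemma prod_card_Cfam Q P (b0 : Yc Q) : (Q <= P)%N ->
  (NP Q * \prod_(p < P.+1) #|Cfam b0 p| <= NP P)%N.
Proof.
move=> QP; rewrite /NP (big_ord_widen_cond P.+1 (fun p => prime p) id) //.
rewrite [X in (X * _)%N]big_mkcond [leqRHS]big_mkcond -big_split /=.
apply: leq_prod => p _; rewrite /Cfam ltnS; case: (leqP p Q) => pQ; last first.
  by rewrite andbF mul1n card_Yfam.
rewrite andbT -[leqRHS]muln1 leq_mul //.
apply/card_le1_eqP => y1 y2; rewrite !unfold_in => /eqP e1 /eqP e2.
by apply: val_inj; rewrite /= e1 e2.
Qed.

(** * Consistency of the laws, and the conditional entropy of a block *)

Section Process.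
Context (A : finType) (mu : law A) (Hp : is_process mu).
Arguments mu : clear implicits.

Lemma law_ge0 m P a b : 0 <= mu m P a b.
Proof. by case: Hp => h _; apply/RleP. Qed.

Lemma law_takeX m n P (le_mn : (m <= n)%N) a b :
  mu m P a b = marginal (takeX le_mn) (fun a' => mu n P a' b) a.
Proof.
case: Hp => _ [hX _].
have idX k (le_kk : (k <= k)%N) (a' : Xc A k) : takeX le_kk a' = a'.
  by apply/ffunP => j; rewrite ffunE; congr (a' _); apply: val_inj.
elim: n => [|n IH] in le_mn *.
  have m0 : m = 0%N by case: m le_mn {a}.
  by subst m; rewrite /marginal; under eq_bigl do rewrite idX; rewrite big_pred1_eq.
have [mn|] := leqP m n; last first.
  move=> nm; have mn : m = n.+1 by apply/eqP; rewrite eqn_leq le_mn nm.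
  by subst m; rewrite /marginal; under eq_bigl do rewrite idX; rewrite big_pred1_eq.
rewrite (IH mn) /marginal big_mkcond [RHS]big_mkcond sum_snocX; apply: eq_bigr => a' _.
under [RHS]eq_bigr do rewrite (takeX_snocX mn).
by case: ifP => _; [exact: hX | rewrite big1].
Qed.

Lemma law_resY m Q P a b : (Q <= P)%N -> mu m Q a b = marginal (@resY Q P) (mu m P a) b.
Proof.
case: Hp => _ [_ hY] /subnKC <-; elim: (P - Q)%N => [|d IH].
  rewrite addn0 /marginal; under eq_bigl do rewrite resY_id.
  by rewrite big_pred1_eq.
rewrite IH addnS /marginal; under eq_bigr do rewrite hY RsumE.
rewrite [RHS](partition_big (@restrictY _) (fun b' => resY Q b' == b)) /=.
  apply: eq_bigr => b' /eqP e; apply: eq_bigl => b''.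
  rewrite -(resY_restrictY b'') ?leq_addr //.
  by case: (eqVneq (restrictY b'') b') => [->|]; rewrite ?e ?eqxx ?andbF.
by move=> b'' /eqP <-; rewrite resY_restrictY ?leq_addr.
Qed.

Context (Hu : hyp_uniform mu).

Lemma probYE P b : probY mu b = (if @validY P b then (NP P)%:R^-1 else 0) :> R.
Proof. by rewrite Hu INRE RinvE. Qed.

Lemma sum_law m P b : \sum_a mu m P a b = (if validY b then (NP P)%:R^-1 else 0) :> R.
Proof.
rewrite -probYE /probY RsumE.
under [RHS]eq_bigr do rewrite (law_takeX (leq0n m)).
by rewrite sum_marginal1.
Qed.

Lemma law_invalid m P a b : ~~ validY b -> mu m P a b = 0.
Proof.
move=> /negbTE vb; have := sum_law m b; rewrite vb => /eqP.
rewrite psumr_eq0 => [/allP/(_ a)|a' _]; last exact: law_ge0.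
by rewrite mem_index_enum => /(_ isT)/eqP.
Qed.

Lemma law_le m P a b : validY b -> mu m P a b <= (NP P)%:R^-1.
Proof.
move=> vb; have := sum_law m b; rewrite vb => <-.
by rewrite (bigD1 a) //= lerDl sumr_ge0 // => *; exact: law_ge0.
Qed.

Lemma law_total m P : \sum_a \sum_b mu m P a b = 1.
Proof.
rewrite exchange_big /=; under eq_bigr do rewrite sum_law.
by rewrite -big_mkcond sum_valid_inv.
Qed.

Context (Hs : hyp_cond_shift mu).

(** Hypothesis (iii) for a singleton; by (i) both conditioning events have probability 1 / [NP P],
    which cancels. *)
Lemma law_window i m P a b : validY b ->
  marginal (@window A i m) (fun a' => mu (i + m)%N P a' (shiftY i b)) a = mu m P a b.
Proof.
move=> vb; have := Hs vb i [set a].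
rewrite !RsumE !RdivE !probYE vb shiftY_valid // invrK.
move/(mulIf (lt0r_neq0 (NPr_gt0 P))).
under eq_bigl do rewrite inE; under [in RHS]eq_bigl do rewrite inE.
by rewrite big_pred1_eq => ->.
Qed.

(** H(x_1, ..., x_m | (y_p)_{p <= P}) by the chain rule H(X, Y) - H(Y), where H(Y) = ln [NP P] by
    uniformity. *)
Definition condent m P : R := (- \sum_b negent (mu m P ^~ b) - ln (NP P)%:R)%R.

Lemma negent_law_invalid m P b : ~~ validY b -> negent (fun a => mu m P a b) = 0.
Proof. by move=> vb; apply: big1 => a _; rewrite law_invalid ?mul0r. Qed.

(** No atom exceeds 1 / [NP P], so its logarithm is at most - ln [NP P]. *)
Lemma condent_ge0 m P : 0 <= condent m P.
Proof.
suff : \sum_b negent (mu m P ^~ b)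
    <= \sum_(b : Yc P | validY b) (NP P)%:R^-1 * - ln (NP P)%:R.
  by rewrite -mulr_suml sum_valid_inv /condent; lra.
rewrite [leRHS]big_mkcond; apply: ler_sum => b _; case: ifPn => vb;
  last by rewrite negent_law_invalid.
have := sum_law m b; rewrite vb => <-; rewrite mulr_suml.
apply: ler_sum => a _; have [->|mu0] := eqVneq (mu m P a b) 0; first by rewrite !mul0r.
rewrite ler_wpM2l ?law_ge0 // -lnV ?posrE ?NPr_gt0 //.
by rewrite ler_ln ?posrE ?invr_gt0 ?NPr_gt0 ?law_le // lt_def mu0 law_ge0.
Qed.

(** Given each b, split the block by [negent_superadditive]. The second part given b + i is
    distributed as the first m variables given b, and summing over b removes the shift. *)
Lemma condent_subadditive i m P : condent (i + m) P <= condent i P + condent m P.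
Proof.
have inj : injective (fun a : Xc A (i + m) => (takeX (leq_addr m i) a, window a)).
  move=> a1 a2 [/ffunP e1 /ffunP e2]; apply/ffunP => j.
  have [k->|k->] := split_ordP j; last by have := e2 k; rewrite !ffunE.
  have := e1 k; rewrite !ffunE.
  by have -> : widen_ord (leq_addr m i) k = lshift m k by exact: val_inj.
pose N : R := (NP P)%:R%R.
suff : \sum_b negent (mu i P ^~ b) + \sum_b negent (mu m P ^~ b)
    <= \sum_b negent (mu (i + m)%N P ^~ b) - ln N by rewrite /condent -/N; lra.
have -> : \sum_b negent (mu m P ^~ b)
    = \sum_b negent (marginal (@window A i m) (mu (i + m)%N P ^~ b)).
  have valid_only n (F : Yc P -> Xc A n -> R) : (forall b a, ~~ validY b -> F b a = 0) ->
      \sum_b negent (F b) = \sum_(b | validY b) negent (F b).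
    move=> F0; rewrite [RHS]big_mkcond; apply: eq_bigr => b _; case: ifPn => // vb.
    by apply: big1 => a _; rewrite F0 // mul0r.
  rewrite !valid_only; first 1 last.
  - by move=> b a vb; apply: big1 => a' _; rewrite law_invalid.
  - by move=> b a vb; rewrite law_invalid.
  rewrite -[RHS](sum_shiftY i); apply: eq_bigr => b vb; apply: eq_bigr => a _.
  by rewrite law_window.
(* The mass terms v ln v, with v = 1 / N at each valid b. *)
have -> : - ln N = \sum_(b : Yc P | validY b) N^-1 * ln N^-1.
  by rewrite -mulr_suml sum_valid_inv mul1r lnV // posrE NPr_gt0.
rewrite [X in _ <= _ + X]big_mkcond -!big_split; apply: ler_sum => b _ /=.
have := @negent_superadditive _ _ _ _ _ _ (mu (i + m)%N P ^~ b) inj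
  (fun a => law_ge0 a b).
rewrite sum_law -/N => h.
have -> : negent (mu i P ^~ b)
   = negent (marginal (takeX (leq_addr m i)) (mu (i + m)%N P ^~ b)).
  by apply: eq_bigr => a _; rewrite (law_takeX (leq_addr m i)).
by move: h; case: ifP => // _; rewrite mul0r.
Qed.

(** The left side is the relative entropy to the law under which the coordinates in (Q, P] are
    uniform and independent of the rest; [ratio] is the probability of each of their values. *)
Lemma condent_diff m Q P (ratio := ((NP Q)%:R / (NP P)%:R)%R : R) : (Q <= P)%N ->
  \sum_a \sum_(b | validY b) mu m P a b *
    (ln (mu m P a b) - ln (mu m Q a (resY Q b) * ratio))
  = condent m Q - condent m P.
Proof.
move=> QP.
have law_res a b : mu m P a b <= mu m Q a (resY Q b).
  by rewrite (law_resY _ _ QP) marginal_ge // => b'; exact: law_ge0.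
pose t : R := (ln (NP Q)%:R - ln (NP P)%:R)%R.
have e a : \sum_(b | validY b) mu m P a b *
    (ln (mu m P a b) - ln (mu m Q a (resY Q b) * ratio))
  = negent (mu m P a) - negent (mu m Q a) - t * \sum_b mu m P a b.
  have -> : negent (mu m Q a) = \sum_b mu m P a b * ln (mu m Q a (resY Q b)).
    rewrite (sum_marginal (@resY Q P) _ (fun b => ln (mu m Q a b))).
    by apply: eq_bigr => b _; rewrite (law_resY _ _ QP).
  rewrite /negent mulr_sumr -!sumrB big_mkcond; apply: eq_bigr => b _.
  have [->|mu0] := eqVneq (mu m P a b) 0; first by rewrite !(mul0r, mulr0) !subr0 if_same.
  have mup : 0 < mu m P a b by rewrite lt_def mu0 law_ge0.
  case: ifPn => vb; last by rewrite law_invalid ?eqxx in mu0.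
  rewrite lnM ?ln_div ?posrE ?divr_gt0 ?NPr_gt0 ?(lt_le_trans mup) //.
  by rewrite -/t; ring.
under eq_bigr do rewrite e.
rewrite !sumrB -mulr_sumr (exchange_big _ _ _ _ _ (mu m P)) /=.
under [X in t * X]eq_bigr do rewrite sum_law.
rewrite -big_mkcond sum_valid_inv /condent /negent.
rewrite (exchange_big _ _ _ _ _ (fun a b => mu m P a b * _)).
rewrite (exchange_big _ _ _ _ _ (fun a b => mu m Q a b * _)) /= /t.
by lra.
Qed.

(** Gibbs inequality against the reference law of [condent_diff]; the hypothesis makes the
    exponential moment of g at most 1 on each fibre of [resY Q]. *)
Lemma law_entropy_bound m Q P (g : Xc A m -> Yc P -> R) : (Q <= P)%N ->
  (forall a b0, (NP Q)%:R * \sum_(b | validY b && (resY Q b == b0)) expR (g a b)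
     <= (NP P)%:R :> R) ->
  \sum_a \sum_b mu m P a b * g a b <= condent m Q - condent m P.
Proof.
move=> QP hg; rewrite -condent_diff //; apply: ler_sum => a _.
set ratio : R := ((NP Q)%:R / (NP P)%:R)%R.
have r0 : 0 < ratio by rewrite divr_gt0 ?NPr_gt0.
have e F : \sum_b mu m P a b * F b = \sum_(b | validY b) mu m P a b * F b.
  rewrite [RHS]big_mkcond; apply: eq_bigr => b _; case: ifPn => // vb.
  by rewrite law_invalid ?mul0r.
rewrite e; apply: le_trans (sum_mul_ln_exp_le _
    (r := fun b => mu m Q a (resY Q b) * ratio) _ _ _) _.
- by move=> b _; exact: law_ge0.
- by move=> b _; rewrite mulr_ge0 ?law_ge0 ?ltW.
- move=> b _ /eqP; rewrite mulf_eq0 (gt_eqF r0) orbF => /eqP h0.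
  apply/eqP; rewrite eq_le law_ge0 andbT -h0 (law_resY _ _ QP).
  by rewrite marginal_ge // => b'; exact: law_ge0.
(* It remains to compare the sum of r e^g with the mass at a, one fibre over [b0] at a time. *)
rewrite -addrA gerDl addrC subr_le0.
have -> : \sum_(b | validY b) mu m P a b = \sum_b0 mu m Q a b0.
  under [RHS]eq_bigr do rewrite (law_resY _ _ QP); rewrite sum_marginal1.
  have := e (fun=> 1); under eq_bigr do rewrite mulr1.
  by under [in RHS]eq_bigr do rewrite mulr1.
rewrite (partition_big (@resY Q P) xpredT) //=; apply: ler_sum => b0 _.
under eq_bigr => b /andP[_ /eqP->] do [].
rewrite -mulr_sumr -mulrA ler_piMr ?law_ge0 //.
by rewrite /ratio mulrAC ler_pdivrMr ?NPr_gt0 // mul1r.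
Qed.

(** The case g = 0, where the hypothesis is the bound on fibre sizes. *)
Lemma condent_antimono m Q P : (Q <= P)%N -> condent m P <= condent m Q.
Proof.
move=> QP; have := law_entropy_bound (m := m) QP (g := fun _ _ => 0%R).
rewrite big1 ?subr_ge0; last by move=> a _; apply: big1 => b _; rewrite mulr0.
apply=> _ b0; under eq_bigr do rewrite expR0.
rewrite sumr_const -natrM ler_nat.
apply: leq_trans (prod_card_Cfam b0 QP); rewrite leq_mul //.
rewrite -card_family_prod; apply: subset_leq_card; apply/subsetP => b.
by rewrite unfold_in => /andP[vb /eqP<-]; exact: resY_Cfam.
Qed.

End Process.

(** * Decoupling *)

Section MidDeviation.
Context (k : nat) (h : 'I_(2 ^ k).+1 -> 'I_(2 ^ k).+1 -> R).
Context (h1 : forall p y : 'I_(2 ^ k).+1, midp p -> (y < p)%N -> `|h p y| <= 1).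

Definition middev (b : Yc (2 ^ k)) : R := deviation (@Yfam (2 ^ k)) (@midp k) h b.

Lemma cntmidE : cntmid k = #|@midp k|.
Proof. by apply: eq_card => p; rewrite inE. Qed.

(** Lets the encoded W_P be replaced by a uniform valid vector. *)
Lemma middev_midY b : middev (midY b) = middev b.
Proof. by apply: eq_bigr => p /andP[_ kp]; rewrite ffunE kp. Qed.

Let h1' p y : midp p -> Yfam p y -> `|h p y| <= 1.
Proof. by move=> mp; rewrite /Yfam /=; have /andP[-> _] := mp; exact: h1. Qed.

Lemma valid_concentration (l : R) : 0 <= l <= 4^-1 ->
  \sum_(b | validY b) expR (l * `|middev b| - 1 - 8 * l ^+ 2 * (cntmid k)%:R)
    <= (NP (2 ^ k))%:R :> R.
Proof.
move=> hl; rewrite -prod_card_Yfam cntmidE.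
under eq_bigl do rewrite validY_family.
exact: (sum_family_expR_norm_le h1' hl).
Qed.

(** 1 + x <= e^x turns the exponential moment into a mean bound. *)
Lemma uniform_deviation (l : R) : 0 <= l <= 4^-1 ->
  \sum_(b | validY b) (NP (2 ^ k))%:R^-1 * (l * `|middev b|)
    <= 1 + 8 * l ^+ 2 * (cntmid k)%:R :> R.
Proof.
move=> hl; have N0 := NPr_gt0 (2 ^ k); set N : R := (NP _)%:R%R in N0 *.
set c : R := (8 * _ * _)%R.
suff : \sum_(b : Yc (2 ^ k) | validY b) N^-1 * (l * `|middev b|)
  <= \sum_(b : Yc (2 ^ k) | validY b)
    (N^-1 * (expR (l * `|middev b| - 1 - c)) + N^-1 * c).
  rewrite big_split /= -mulr_suml sum_valid_inv mul1r -[X in _ <= X + _]mulr_sumr.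
  have := valid_concentration hl; rewrite -/c -/N => hN.
  have : N^-1 * \sum_(b | validY b) expR (l * `|middev b| - 1 - c) <= 1.
    by rewrite mulrC ler_pdivrMr // mul1r.
  by lra.
apply: ler_sum => b _; rewrite -mulrDr ler_wpM2l ?invr_ge0 ?(ltW N0) //.
by have := expR_ge1Dx (l * `|middev b| - 1 - c); lra.
Qed.

End MidDeviation.

(** Primes p > 2^k stay free when the coordinates up to 2^k are fixed, so concentration holds on
    every fibre with the same means. *)
Lemma fibre_concentration k (h : 'I_(2 ^ k.+1).+1 -> 'I_(2 ^ k.+1).+1 -> R)
    (b0 : Yc (2 ^ k)) (l : R) :
  (forall p y : 'I_(2 ^ k.+1).+1, midp p -> (y < p)%N -> `|h p y| <= 1) ->
  0 <= l <= 4^-1 ->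
  (NP (2 ^ k))%:R * \sum_(b | validY b && (resY (2 ^ k) b == b0))
      expR (l * `|middev h b| - 1 - 8 * l ^+ 2 * (cntmid k.+1)%:R)
    <= (NP (2 ^ k.+1))%:R :> R.
Proof.
move=> h1 hl.
have QP : (2 ^ k <= 2 ^ k.+1)%N by rewrite leq_exp2l.
have midC (p : 'I_(2 ^ k.+1).+1) : midp p -> Cfam b0 p = Yfam p.
  move=> /andP[_ kp].
  have {}kp : (2 ^ k < p)%N by rewrite -(ltn_pmul2l (m := 2)) // -expnS.
  by rewrite /Cfam leqNgt kp.
have h1' (p y : 'I_(2 ^ k.+1).+1) : midp p -> Cfam b0 p y -> `|h p y| <= 1.
  by move=> mp; rewrite midC // /Yfam /=; have /andP[-> _] := mp; exact: h1.
have hC := sum_family_expR_norm_le h1' hl.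
apply: le_trans (_ : (NP (2 ^ k))%:R *
  (\prod_(p < (2 ^ k.+1).+1) #|Cfam b0 p|)%N%:R <= _); last first.
  by rewrite -natrM ler_nat prod_card_Cfam.
rewrite ler_wpM2l //; apply: le_trans hC.
rewrite -cntmidE big_mkcond [leRHS]big_mkcond; apply: ler_sum => b _.
case: ifPn => [/andP[vb /eqP e]|_]; last by case: ifP; rewrite ?expR_ge0.
rewrite -{1}e resY_Cfam // /middev /deviation.
by under [in leRHS]eq_bigr => p mp do rewrite midC //.
Qed.

Lemma cnorm_le (z : R * R) : cnorm z <= `|z.1| + `|z.2|.
Proof.
rewrite /cnorm RsqrtE RplusE !RmultE.
rewrite -[leRHS]ger0_norm ?addr_ge0 // -sqrtr_sqr ler_wsqrtr //.
rewrite sqrrD !real_normK ?num_real // !expr2.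
by have : 0 <= `|z.1| * `|z.2| := mulr_ge0 (normr_ge0 _) (normr_ge0 _); lra.
Qed.

Lemma cnorm_ge (z : R * R) : `|z.1| <= cnorm z /\ `|z.2| <= cnorm z.
Proof.
rewrite /cnorm RsqrtE RplusE !RmultE -!expr2.
by split; rewrite -sqrtr_sqr ler_wsqrtr // ?lerDl ?lerDr sqr_ge0.
Qed.

(** The means subtracted in [middev] are the same for b and w, hence cancel. *)
Lemma avgmid_diff k (h : 'I_(2 ^ k).+1 -> 'I_(2 ^ k).+1 -> R) (b w : Yc (2 ^ k)) :
  (0 < cntmid k)%N ->
  avgmid (fun p => h p (b p)) - avgmid (fun p => h p (w p))
    = (middev h b - middev h w) / (cntmid k)%:R.
Proof.
rewrite /avgmid; case: (cntmid k) => // n _.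
rewrite !RsumE !RdivE !INRE -mulrBl /middev /deviation -!sumrB.
by congr (_ / _); apply: eq_bigr => p _; ring.
Qed.

Section Decoupling.
Context (A : finType) (mu : law A) (Hp : is_process mu) (Hu : hyp_uniform mu).
Arguments mu : clear implicits.

Lemma law_deviation m k
    (h : Xc A m -> 'I_(2 ^ k.+1).+1 -> 'I_(2 ^ k.+1).+1 -> R) (l : R) :
  (forall a (p y : 'I_(2 ^ k.+1).+1), midp p -> (y < p)%N -> `|h a p y| <= 1) ->
  0 <= l <= 4^-1 ->
  \sum_a \sum_b mu m (2 ^ k.+1)%N a b * (l * `|middev (h a) b|)
    <= 1 + 8 * l ^+ 2 * (cntmid k.+1)%:R
       + (condent mu m (2 ^ k) - condent mu m (2 ^ k.+1)).
Proof.
move=> h1 hl; set c : R := (8 * _ * _)%R.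
have QP : (2 ^ k <= 2 ^ k.+1)%N by rewrite leq_exp2l.
have := law_entropy_bound Hp Hu QP
  (g := fun a b => (l * `|middev (h a) b| - 1 - c)%R)
  (fun a b0 => fibre_concentration b0 (h1 a) hl).
suff -> : \sum_a \sum_b mu m (2 ^ k.+1)%N a b * (l * `|middev (h a) b| - 1 - c)
   = \sum_a \sum_b mu m (2 ^ k.+1)%N a b * (l * `|middev (h a) b|) - (1 + c).
  by move=> ?; lra.
rewrite -[X in _ - X]mul1r -(law_total Hp Hu m (2 ^ k.+1)) mulr_suml -sumrB.
apply: eq_bigr => a _; rewrite mulr_suml -sumrB; apply: eq_bigr => b _.
by ring.
Qed.

Context (C : nat) (f : fam A C) (Hf : one_bounded f).
Arguments f : clear implicits.

(** Triangle inequality through the common mean, for real and imaginary parts. Y_P costs 2 c + 2 D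
    by [law_deviation]; W_P, independent of X_P, costs 2 c by [uniform_deviation]. *)
Lemma Ediff_bound k
    (kap : Xc A (C * 2 ^ k.+1) -> Yc (2 ^ k.+1) -> Yc (2 ^ k.+1) -> R) (l : R)
    (m := (C * 2 ^ k.+1)%N) (n := cntmid k.+1) :
  coupling mu kap -> (0 < n)%N -> 0 <= l <= 4^-1 ->
  l * n%:R * Ediff f kap <= 4 * (1 + 8 * l ^+ 2 * n%:R)
     + 2 * (condent mu m (2 ^ k) - condent mu m (2 ^ k.+1)).
Proof.
move=> [kap0 [kapY [kapW kapI]]] n0 hl.
set c : R := (1 + _)%R; set D : R := (_ - _)%R.
pose h1 a (p y : 'I_(2 ^ k.+1).+1) := (f k.+1 p a y).1.
pose h2 a (p y : 'I_(2 ^ k.+1).+1) := (f k.+1 p a y).2.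
have hb a (p y : 'I_(2 ^ k.+1).+1) : midp p -> (y < p)%N -> cnorm (f k.+1 p a y) <= 1.
  by move=> /andP[pp kp] yp; apply/RleP; apply: Hf => //; rewrite -ltnS.
have h1b a (p y : 'I_(2 ^ k.+1).+1) : midp p -> (y < p)%N -> `|h1 a p y| <= 1.
  by move=> mp yp; apply: le_trans (hb a p y mp yp); have [] := cnorm_ge (f k.+1 p a y).
have h2b a (p y : 'I_(2 ^ k.+1).+1) : midp p -> (y < p)%N -> `|h2 a p y| <= 1.
  by move=> mp yp; apply: le_trans (hb a p y mp yp); have [] := cnorm_ge (f k.+1 p a y).
pose G a b : R := (l * `|middev (h1 a) b| + l * `|middev (h2 a) b|)%R.
have l0 : 0 <= l by case/andP: hl.
have n0R : 0 < n%:R :> R by rewrite ltr0n.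
have point a b w : l * n%:R * cnorm (cdiff (fP f a b) (fP f a w)) <= G a b + G a w.
  apply: le_trans (ler_wpM2l _ (cnorm_le _)) _; first by rewrite mulr_ge0 // ltW.
  rewrite /cdiff /= !RminusE (avgmid_diff (h1 a)) // (avgmid_diff (h2 a)) //.
  rewrite -/n !normrM normfV normr_nat -mulrDl mulrA mulrAC mulfK ?gt_eqF //.
  have := ler_wpM2l l0 (ler_normB (middev (h1 a) b) (middev (h1 a) w)).
  have := ler_wpM2l l0 (ler_normB (middev (h2 a) b) (middev (h2 a) w)).
  by rewrite /G; lra.
have step : l * n%:R * Ediff f kap <= \sum_a \sum_b mu m (2 ^ k.+1)%N a b * G a b
   + \sum_a \sum_w (\sum_b kap a b w) * G a w.
  rewrite /Ediff RsumE mulr_sumr -big_split; apply: ler_sum => a _ /=.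
  under [X in _ <= _ + X]eq_bigr do rewrite mulr_suml.
  rewrite [X in _ <= _ + X]exchange_big -big_split RsumE mulr_sumr.
  apply: ler_sum => b _ /=.
  rewrite -kapY !RsumE mulr_suml -big_split mulr_sumr; apply: ler_sum => w _ /=.
  by rewrite RmultE mulrCA -mulrDr ler_wpM2l //; apply/RleP.
apply: le_trans step _.
have partY : \sum_a \sum_b mu m (2 ^ k.+1)%N a b * G a b <= 2 * c + 2 * D.
  under eq_bigr do (under eq_bigr do rewrite mulrDr); under eq_bigr do rewrite big_split.
  rewrite big_split /=.
  by have := law_deviation h1b hl; have := law_deviation h2b hl; rewrite -/c -/D; lra.
suff partW : \sum_a \sum_w (\sum_b kap a b w) * G a w <= 2 * c by lra.
have GW a : \sum_w (\sum_a' \sum_b kap a' b w) * G a w <= 2 * c.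
  have -> : \sum_w (\sum_a' \sum_b kap a' b w) * G a w
      = \sum_(b | validY b) (NP (2 ^ k.+1))%:R^-1 * G a b.
    (* W_P is distributed as the middle part of a uniform valid vector. *)
    have kW w : \sum_a' \sum_b kap a' b w
        = marginal (@midY k.+1) 
            (fun b => if validY b then (NP (2 ^ k.+1))%:R^-1%R else 0%R) w.
      have := kapW w; rewrite !RsumE => ->; under eq_bigr do rewrite RsumE.
      by rewrite exchange_big; apply: eq_bigr => b _; rewrite -(sum_law Hp Hu m).
    under eq_bigr do rewrite kW.
    rewrite -sum_marginal [RHS]big_mkcond; apply: eq_bigr => b _.
    by rewrite /G !middev_midY; case: ifP; rewrite ?mul0r.
  under eq_bigr do rewrite mulrDr; rewrite big_split /=.
  have := uniform_deviation (h1b a) hl; have := uniform_deviation (h2b a) hl.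
  by rewrite -/c; lra.
apply: le_trans (_ : \sum_a (\sum_b mu m (2 ^ k.+1)%N a b) * (2 * c) <= _); last first.
  by rewrite -mulr_suml (law_total Hp Hu) mul1r.
apply: ler_sum => a _.
apply: le_trans (ler_wpM2l _ (GW a)); last by apply: sumr_ge0 => b _; exact: law_ge0.
rewrite mulr_sumr; apply: ler_sum => w _.
by have := kapI a w; rewrite !RsumE RmultE => ->; rewrite mulrA.
Qed.

End Decoupling.

(** * The choice of the scale *)

(** [prime_scales_heavy] divided by 4 * 2^K: every tail of the series reaches 1/4. *)
Lemma sum_cntmid_ge (R : realType) N : exists2 K, (N <= K)%N &
  4^-1 <= \sum_(N <= k < K) (cntmid k.+1)%:R / 2 ^+ k.+1 :> R.
Proof.
have [K NK hK] := prime_scales_heavy N; exists K => //.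
have p0 j : 0 < 2 ^+ j :> R by rewrite exprn_gt0.
move: hK; rewrite -(ler_nat R) natrX natrM natr_sum big_add1 /=.
have -> : \sum_(N <= k < K) (cntmid k.+1 * 2 ^ (K - k.+1).+1)%N%:R
   = 2 * 2 ^+ K * \sum_(N <= k < K) (cntmid k.+1)%:R / 2 ^+ k.+1 :> R.
  rewrite mulr_sumr !big_nat; apply: eq_bigr => k /andP[_ kK].
  rewrite natrM natrX exprS -(subnK kK) exprD addnK.
  by field; rewrite lt0r_neq0.
by move=> hK; rewrite -(ler_pM2l (p0 K)); lra.
Qed.

(* If no such [k] existed, the nonnegative sequence [(d * M + u k) / 2 ^+ k] would
   drop by [d / 4] infinitely often. *)
Lemma entropy_decrement (R : realType) (u D : nat -> R) (d : R) (M N : nat) :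
  (forall k, 0 <= u k) -> (forall k, 0 <= D k) ->
  (forall k, D k <= 2 * u k - u k.+1) -> 0 < d ->
  exists k, [/\ (N <= k)%N, (M <= cntmid k.+1)%N & D k <= d * (cntmid k.+1)%:R].
Proof.
move=> u0 D0 Du d0; apply: contrapT => no.
(* Failure at k means n_k+1 < M or D k > d n_k+1, where n_k+1 is [cntmid k.+1]; one summand suffices
   in either case. *)
have big k : (N <= k)%N -> d * (cntmid k.+1)%:R <= d * M%:R + D k.
  move=> Nk; have [nM|Mn] := leqP (cntmid k.+1) M.
    by rewrite ler_wpDr // ler_wpM2l ?ler_nat // ltW.
  rewrite ler_wpDl ?mulr_ge0 ?(ltW d0) //; apply/ltW; rewrite ltNge; apply/negP => h.
  by apply: no; exists k; split=> //; apply: ltnW.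
(* In 2 (d M + u k) - (d M + u k.+1) one copy of d M survives, which pays for the d M in [big]. *)
pose t k := (d * M%:R + u k) / 2 ^+ k.
have p0 j : 0 < 2 ^+ j :> R by rewrite exprn_gt0.
have t0 k : 0 <= t k by rewrite divr_ge0 ?addr_ge0 ?mulr_ge0 ?(ltW d0) // ltW.
have tstep k : (N <= k)%N -> d * ((cntmid k.+1)%:R / 2 ^+ k.+1) <= t k - t k.+1.
  move=> Nk.
  have -> : t k - t k.+1 = (2 * (d * M%:R + u k) - (d * M%:R + u k.+1)) / 2 ^+ k.+1.
    by rewrite /t exprS; field; rewrite lt0r_neq0.
  rewrite mulrA ler_wpM2r ?invr_ge0 ?(ltW (p0 _)) //.
  by have := big _ Nk; have := Du k; lra.
have drop N' : (N <= N')%N -> exists2 K, (N' <= K)%N & t K <= t N' - d / 4.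
  move=> NN; have [K NK hK] := sum_cntmid_ge R N'; exists K => //.
  have : \sum_(N' <= k < K) d * ((cntmid k.+1)%:R / 2 ^+ k.+1)
      <= \sum_(N' <= k < K) (t k - t k.+1).
    rewrite !big_nat; apply: ler_sum => k /andP[? _].
    by apply: tstep; apply: leq_trans NN _.
  have -> : \sum_(N' <= k < K) (t k - t k.+1) = t N' - t K.
    rewrite -[RHS]opprB -telescope_sumr // -sumrN.
    by apply: eq_bigr => k _; rewrite opprB.
  by rewrite -mulr_sumr; have := ler_wpM2l (ltW d0) hK; lra.
have iter j : exists2 K, (N <= K)%N & t K <= t N - j%:R * (d / 4).
  elim: j => [|j [K NK hK]]; first by exists N => //; rewrite mul0r subr0.
  have [K' KK hK'] := drop K NK; exists K'; first exact: leq_trans KK.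
  by rewrite -natr1 mulrDl mul1r; lra.
have d4 : 0 < d / 4 by rewrite divr_gt0.
have [K NK] := iter (Num.bound (t N / (d / 4))).
have := archi_boundP (divr_ge0 (t0 N) (ltW d4)); rewrite ltr_pdivrMr // => h1 h2.
by have := t0 K; lra.
Qed.

Local Close Scope ring_scope.

(** * From the entropy decrement to the vanishing lower limit *)

Theorem theorem2p14 (A : finType) (C : nat) (mu : law A) :
  is_process mu -> hyp_uniform mu -> hyp_stationary mu -> hyp_cond_shift mu ->
  forall f : fam A C, one_bounded f ->
  forall kap : forall k : nat,
      {ffun 'I_(C * 2 ^ k) -> A} -> {ffun 'I_(2 ^ k).+1 -> 'I_(2 ^ k).+1} ->
      {ffun 'I_(2 ^ k).+1 -> 'I_(2 ^ k).+1} -> R,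
  (forall k, coupling mu (kap k)) ->
  (* liminf_{k -> oo} E|f_P(X_P,Y_P) - f_P(X_P,W_P)| = 0 with P = 2^k
     (the terms are >= 0, so this is: for all eps > 0 the terms are < eps
      infinitely often) *)
  forall eps : R, (0 < eps)%Re ->
  forall N : nat, exists k : nat, (N <= k)%N /\ (Ediff f (kap k) < eps)%Re.
Proof.
move=> Hp Hu _ Hs f Hf kap Hkap eps /RltP eps0 N.
(* 1/4 is the limit of the moment bound. With d = l^2 and l^2 n >= 1, [Ediff_bound] gives at most 4
   + 34 l^2 n <= 38 l^2 n; dividing by l n leaves 38 l < eps. *)
pose l : R := (Num.min 4^-1 (eps / 40))%R.
have l0 : (0 < l)%R by rewrite lt_min invr_gt0 ltr0n divr_gt0.
have hl : (0 <= l <= 4^-1)%R by rewrite ltW //= ge_min lexx.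
have le : (l <= eps / 40)%R by rewrite ge_min lexx orbT.
have l2 : (0 < l ^+ 2)%R by rewrite exprn_gt0.
pose u k := condent mu (C * 2 ^ k) (2 ^ k).
pose D k := (condent mu (C * 2 ^ k.+1) (2 ^ k) - condent mu (C * 2 ^ k.+1) (2 ^ k.+1))%R.
have D0 k : (0 <= D k)%R.
  by rewrite subr_ge0; apply: condent_antimono => //; rewrite leq_exp2l.
(* The block of length C 2^(k+1) is cut into two halves, still conditioned on primes up to 2^k. *)
have Du k : (D k <= 2 * u k - u k.+1)%R.
  rewrite /D lerD2r.
  have -> : C * 2 ^ k.+1 = C * 2 ^ k + C * 2 ^ k by rewrite expnS; lia.
  by rewrite mulr_natl mulr2n; apply: condent_subadditive.
have [k [Nk Mk Dk]] := entropy_decrement (Num.bound (l ^+ 2)^-1).+1 N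
  (fun k => condent_ge0 Hp Hu _ _ : (0 <= u k)%R) D0 Du l2.
exists k.+1; split; first exact: leqW.
set n := cntmid k.+1 in Mk Dk.
have n0 : 0 < n by apply: leq_trans Mk.
have ln : (1 <= l ^+ 2 * n%:R)%R.
  have := archi_boundP (ltW (_ : 0 < (l ^+ 2)^-1)%R); rewrite invr_gt0 => /(_ l2) h.
  rewrite mulrC -ler_pdivrMr // div1r (le_trans (ltW h)) // ler_nat.
  exact: ltnW.
have := Ediff_bound Hp Hu Hf (Hkap k.+1) n0 hl; rewrite -/(D k) -/n => hE.
apply/RltP; apply: le_lt_trans (_ : (38 * l < eps)%R); last by lra.
have ln0 : (0 < l * n%:R)%R by rewrite mulr_gt0 ?ltr0n.
rewrite -(ler_pM2l ln0); apply: le_trans hE _.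
have -> : (l * n%:R * (38 * l) = 38 * (l ^+ 2 * n%:R))%R by ring.
by lra.
Qed.
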